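(* Let $k>0$, $p\geq k$ and $q\geq p$ be integers. If $p=q$, then $\gamma(q,q,k)=1$. If $p>k$, then $\gamma(q,p,k)\geq\gamma(q-p+k,k,k)$. Otherwise (i.e., if $p=k<q$), $$\gamma(q,k,k)\geq\frac{2}{\sum_{r=0}^k\binom{q}{r}\binom{q-1-r}{k-r}+1}.$$
   Context: Let $\Sigma_q=\{0,1,\ldots,q-1\}$. Arrays with $R$ rows and $q$ columns (indexed by $\Sigma_q$) on $\Sigma_q$ are multisets of $R$ words of $\Sigma_q^q$; $\mu^M(u)$ is the fraction of rows of $M$ equal to $u$. For integers $q\ge p\ge k>0$, a $(q,p)$-alphabet reduction pair of arrays (ARPA) of strength $k$ is a pair $(\Psi,\Phi)$ of arrays with $q$ columns, entries in $\Sigma_q$ and the same number of rows such that: (1) $\Phi$ contains at least one row equal to $(0,1,\ldots,q-1)$; (2) each row of $\Psi$ has at most $p$ distinct values among its components; (3) $\mu^\Psi-\mu^\Phi$ is balanced $k$-wise independent, i.e., for all columns $j_1<\cdots<j_k$ in $\Sigma_q$ and all $v\in\Sigma_q^k$, the rows of $\Psi$ and of $\Phi$ restricted to columns $j_1,\ldots,j_k$ coincide with $v$ equally often. For integers $R\geq R^*>0$, $\Gamma(R,R^*,q,p,k)$ is the set of such pairs in which $\Psi$ and $\Phi$ have $R$ rows each and the row $(0,1,\ldots,q-1)$ occurs exactly $R^*$ times in $\Phi$. $\gamma(q,p,k)$ is the largest number $\gamma$ such that $\Gamma(R,R^*,q,p,k)\neq\emptyset$ for some integers $R\geq R^*>0$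 with $R^*/R=\gamma$. *)

(* Defs.v *)
From mathcomp Require Import all_boot all_order all_algebra.
From mathcomp Require Import boolp classical_sets.

Set Implicit Arguments.
Unset Strict Implicit.
Unset Printing Implicit Defensive.

Import Order.TTheory GRing.Theory Num.Theory.

(* [u j] is the entry of the word [u] in column [j]. *)
Definition word (q : nat) : finType := {ffun 'I_q -> 'I_q}.

(* A multiset of R words is listed in an arbitrary order: everything below uses
   only membership, [all] and [count], which do not depend on that order. *)
Definition array (R q : nat) : Type := R.-tuple (word q).

(* The word (0, 1, ..., q - 1). *)
Definition idword (q : nat) : word q := [ffun j => j].

Definition nvalues (q : nat) (u : word q) : nat := #|[set u j | j : 'I_q]|.

(* [u] restricted to the columns J 0, ..., J (k - 1) is [v]. *)
Definition matches (q k : nat) (J v : 'I_k -> 'I_q) (u : word q) : bool :=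
  [forall l : 'I_k, u (J l) == v l].

(* As Psi and Phi have the same number of rows, comparing frequencies amounts
   to comparing numbers of occurrences. *)
Definition balanced_difference (R q k : nat) (Psi Phi : array R q) : Prop :=
  forall J : 'I_k -> 'I_q, (forall l m : 'I_k, l < m -> J l < J m) ->
  forall v : 'I_k -> 'I_q,
    count (matches J v) Psi = count (matches J v) Phi.

Definition is_ARPA (R q p k : nat) (Psi Phi : array R q) : Prop :=
  [/\ idword q \in Phi,
      all (fun u => nvalues u <= p) Psi
    & balanced_difference k Psi Phi].

(* Membership of (Psi, Phi) in Gamma(R, R*, q, p, k). *)
Definition in_Gamma (R Rs q p k : nat) (Psi Phi : array R q) : Prop :=
  is_ARPA p k Psi Phi /\ count_mem (idword q) Phi = Rs.

Definition Gamma_nonempty (R Rs q p k : nat) : Prop :=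
  exists Psi Phi : array R q, in_Gamma Rs p k Psi Phi.

Definition Gamma_ratio (q p k : nat) (g : rat) : Prop :=
  exists R Rs : nat,
    [/\ 0 < Rs, Rs <= R, Gamma_nonempty R Rs q p k
      & g = (Rs%:R / R%:R)%R].

Definition is_largest (A : rat -> Prop) (g : rat) : Prop :=
  A g /\ forall h, A h -> (h <= g)%R.

(* The default value 0 is only taken when there is no ratio at all:
   see [gammaP]. *)
Definition gamma (q p k : nat) : rat := xget 0%R (is_largest (Gamma_ratio q p k)).

(* The rest of this file proves [gammaP]. Integer solutions that are not sums
   of smaller ones contain no infinite sequence of distinct terms, by
   Dickson's lemma, and some solution of this kind attains the maximum. *)

Section Dickson.

Lemma nondecr_subseq (h : nat -> nat) :
  exists g : nat -> nat, (forall i j, i < j -> g i < g j) /\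
    (forall i j, i <= j -> h (g i) <= h (g j)).
Proof.
have tailmin n : exists m, n <= m /\ forall m', n <= m' -> h m <= h m'.
  have ex : exists v, `[< exists2 m, n <= m & h m = v >].
    by exists (h n); apply/asboolP; exists n.
  case: (ex_minnP ex) => v /asboolP[m nm <-] mmin.
  by exists m; split=> // m' nm'; apply: mmin; apply/asboolP; exists m'.
have [mu muP] := choice tailmin.
pose g := fix g i := if i is i'.+1 then mu (g i').+1 else mu 0.
have gS i : g i < g i.+1 by have [] := muP (g i).+1.
have ginc : {homo g : i j / i < j} by apply: homo_ltn gS => ? ? ?; apply: ltn_trans.
exists g; split=> // i j; rewrite leq_eqVlt => /orP[/eqP->//|ij].
case: i ij => [|i] ij; first by have [_] := muP 0; apply.
by have [_] := muP (g i).+1; apply; apply: ginc; apply: ltnW.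
Qed.

Lemma dickson (T : finType) (f : nat -> {ffun T -> nat}) :
  exists i j, i < j /\ forall t, f i t <= f j t.
Proof.
suff [g [ginc gP]] : exists g : nat -> nat, (forall i j, i < j -> g i < g j) /\
    forall t, t \in enum T -> forall i j, i <= j -> f (g i) t <= f (g j) t.
  by exists (g 0), (g 1); split=> [|t]; [apply: ginc | apply: gP; rewrite ?mem_enum].
elim: (enum T) => [|t s [g [ginc gP]]]; first by exists id.
have [g' [ginc' gP']] := nondecr_subseq (fun i => f (g i) t).
exists (g \o g'); split=> [i j ij /=|u]; first by apply/ginc/ginc'.
rewrite inE => /orP[/eqP->|us] i j ij; first exact: gP'.
apply: gP => //; move: ij; rewrite leq_eqVlt => /orP[/eqP->//|ij].
by apply/ltnW/ginc'.
Qed.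

End Dickson.

Section ConeMax.

Variables (T : finType) (S : {ffun T -> nat} -> Prop).
Variables (num den : {ffun T -> nat} -> nat).

Let vle (y x : {ffun T -> nat}) := forall t, y t <= x t.
Let vsub (x y : {ffun T -> nat}) : {ffun T -> nat} := [ffun t => x t - y t].

Hypothesis S_sub : forall x y, S x -> S y -> vle y x -> S (vsub x y).
Hypothesis numB : forall x y, vle y x -> num x = num y + num (vsub x y).
Hypothesis denB : forall x y, vle y x -> den x = den y + den (vsub x y).
Hypothesis den_eq0 : forall x y, S x -> S y -> vle y x -> den (vsub x y) = 0 -> x = y.

Let A x := S x /\ 0 < den x.
Let rle x y := num x * den y <= num y * den x.
Let indec x := A x /\ forall y, A y -> vle y x -> x = y.

Let rle_trans x y z : A y -> rle x y -> rle y z -> rle x z.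
Proof.
move=> [_ y0] xy yz; rewrite /rle -(leq_pmul2r y0) mulnAC.
apply: (leq_trans (leq_mul xy (leqnn _))).
rewrite mulnAC; apply: (leq_trans (leq_mul yz (leqnn _))).
by rewrite mulnAC.
Qed.

Let indec_above x : A x -> exists2 y, indec y & rle x y.
Proof.
have [n] := ubnP (den x); elim: n x => // n IH x /ltnSE dx Ax.
have [xi|/existsNP[y /not_implyP[Ay /not_implyP[yx xNy]]]] :=
  pselect (forall y, A y -> vle y x -> x = y); first by exists x; rewrite /rle.
have d0 : 0 < den (vsub x y).
  by rewrite lt0n; apply/eqP => /(den_eq0 (proj1 Ax) (proj1 Ay) yx).
have Az : A (vsub x y) by split=> //; apply: S_sub => //; [case: Ax|case: Ay].
have nE := numB yx; have dE := denB yx.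
have [le|lt] := leqP (num x * den y) (num y * den x).
  have [|z iz yz] := IH y _ Ay.
    by apply: leq_trans dx; rewrite dE -[X in X < _]addn0 ltn_add2l.
  exists z => //; exact: rle_trans yz.
have [|z iz yz] := IH (vsub x y) _ Az.
  apply: leq_trans dx; rewrite dE -[X in X < _]add0n ltn_add2r.
  by case: Ay.
exists z => //; apply: rle_trans yz => //.
rewrite /rle; move: lt; rewrite nE dE !mulnDl !mulnDr.
rewrite !ltn_add2l => lt; rewrite leq_add2r.
exact: ltnW.
Qed.

Lemma cone_max x0 : S x0 -> 0 < den x0 ->
  exists x, [/\ S x, 0 < den x &
    forall y, S y -> 0 < den y -> num y * den x <= num x * den y].
Proof.
move=> Sx0 dx0; apply: contrapT => nomax.
have step (x : {x | indec x}) : exists y : {y | indec y}, ~ rle (sval y) (sval x).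
  case: x => x [Ax xi] /=; apply: contrapT => xmax; apply: nomax.
  exists x; case: (Ax) => Sx dx; split=> // y Sy dy.
  have [z iz yz] := indec_above (conj Sy dy).
  apply: (rle_trans _ yz); first by case: iz.
  by apply: contrapT => zx; apply: xmax; exists (exist _ z iz).
have [nx nxP] := choice step.
have [x1 ix1 _] := indec_above (conj Sx0 dx0).
pose f i := iter i nx (exist _ x1 ix1).
have finc i j : i < j -> rle (sval (f i)) (sval (f j)) /\
    ~ rle (sval (f j)) (sval (f i)).
  elim: j => // j IH; rewrite ltnS leq_eqVlt => /orP[/eqP->|/IH [ij ji]].
    split; last exact: nxP.
    by have := nxP (f j); rewrite /rle => /negP; rewrite -ltnNge => /ltnW.
  have Aj : A (sval (f j)) by case: (f j) => ? [].
  have Ai : A (sval (f i)) by case: (f i) => ? [].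
  have jj : rle (sval (f j)) (sval (f j.+1)).
    by have := nxP (f j); rewrite /rle => /negP; rewrite -ltnNge => /ltnW.
  split; first exact: rle_trans jj.
  by move=> h; apply: (nxP (f j)); apply: (rle_trans Ai h ij).
have [i [j [ij le]]] := dickson (fun i => sval (f i)).
have [fij fji] := finc i j ij; apply: fji.
have [_ ind] := svalP (f j).
have Ai : A (sval (f i)) by case: (f i) => ? [].
by rewrite (ind _ Ai le) /rle.
Qed.

End ConeMax.

Section GammaMax.

Variables (q p k : nat).

Let W := word q.

Lemma count_mult (P : pred W) (s : seq W) :
  count P s = \sum_(u | P u) count_mem u s.
Proof.
elim: s => [|a s IH] /=; first by rewrite big1.
rewrite big_split /= -IH; congr (_ + _).
rewrite big_mkcond (bigD1 a) //= eqxx big1 ?addn0; first by case: (P a).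
by move=> u ua; rewrite eq_sym (negPf ua); case: (P u).
Qed.

Let seq_of (a : W -> nat) : seq W := flatten [seq nseq (a u) u | u <- enum W].

Let count_seq_of a u : count_mem u (seq_of a) = a u.
Proof.
rewrite /seq_of count_flatten -map_comp sumnE big_map big_enum /=.
rewrite (bigD1 u) //= count_nseq /= eqxx mul1n big1 ?addn0 // => v vu.
by rewrite count_nseq /= (negPf vu).
Qed.

(* Joint multiplicities of the rows of Psi (left) and Phi (right). *)
Let V := {ffun W + W -> nat}.
Let num (x : V) := x (inr (idword q)).
Let den (x : V) := \sum_u x (inl u).
Let sol (x : V) : Prop :=
  [/\ \sum_u x (inl u) = \sum_u x (inr u),
      forall u, 0 < x (inl u) -> nvalues u <= p &
      forall J : 'I_k -> 'I_q, (forall l m : 'I_k, l < m -> J l < J m) ->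
        forall v, \sum_(u | matches J v u) x (inl u)
                = \sum_(u | matches J v u) x (inr u)].

Let sol_of R Rs (Psi Phi : array R q) : in_Gamma Rs p k Psi Phi ->
  exists x, [/\ sol x, num x = Rs & den x = R].
Proof.
move=> [[_ /allP Psip bal] <-].
pose x : V := [ffun t => match t with inl u => count_mem u Psi
                                    | inr u => count_mem u Phi end].
have xl (P : pred W) : \sum_(u | P u) x (inl u) = count P Psi.
  by rewrite count_mult; apply: eq_bigr => u _; rewrite ffunE.
have xr (P : pred W) : \sum_(u | P u) x (inr u) = count P Phi.
  by rewrite count_mult; apply: eq_bigr => u _; rewrite ffunE.
exists x; split; rewrite /num /den ?xl ?ffunE ?count_predT ?size_tuple //.
split; first by rewrite xl xr !count_predT !size_tuple.
- by move=> u; rewrite ffunE -has_count has_pred1 => /Psip.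
- by move=> J Jinc v; rewrite xl xr; apply: bal.
Qed.

Let of_sol x : sol x -> 0 < num x ->
  Gamma_nonempty (den x) (num x) q p k /\ num x <= den x.
Proof.
move=> [eqR xp bal] x0.
have sl : size (seq_of (fun u => x (inl u))) == den x.
  rewrite -count_predT count_mult; apply/eqP.
  by apply: eq_bigr => u _; rewrite count_seq_of.
have sr : size (seq_of (fun u => x (inr u))) == den x.
  rewrite -count_predT count_mult /den eqR; apply/eqP.
  by apply: eq_bigr => u _; rewrite count_seq_of.
split; last by rewrite /den eqR (bigD1 (idword q)) //= leq_addr.
exists (Tuple sl), (Tuple sr); split; last exact: count_seq_of.
split.
- by rewrite -has_pred1 has_count [X in 0 < X]count_seq_of.
- apply/allP => u; rewrite -has_pred1 has_count [X in 0 < X]count_seq_of.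
  exact: xp.
- move=> J Jinc v; rewrite /= !count_mult.
  under eq_bigr do rewrite count_seq_of.
  under [RHS]eq_bigr do rewrite count_seq_of.
  exact: bal.
Qed.

Lemma Gamma_ratio_max : (exists g, Gamma_ratio q p k g) ->
  exists g, is_largest (Gamma_ratio q p k) g.
Proof.
case=> g0 [R0 [Rs0 [Rs0_gt0 leR0 [Psi0 [Phi0 /sol_of[x0 [sx0 nx0 dx0]]]] _]]].
have sumB (F : W -> W + W) (P : pred W) (x y : V) : (forall t, y t <= x t) ->
    \sum_(u | P u) [ffun t => x t - y t] (F u)
    = \sum_(u | P u) x (F u) - \sum_(u | P u) y (F u).
  move=> yx; rewrite -bigop.sumnB // => *; by apply: eq_bigr => u _; rewrite ffunE.
have sumle (F : W -> W + W) (P : pred W) (x y : V) : (forall t, y t <= x t) ->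
    \sum_(u | P u) y (F u) <= \sum_(u | P u) x (F u).
  by move=> yx; apply: leq_sum.
have Sg x y : sol x -> sol y -> (forall t, y t <= x t) ->
    sol [ffun t => x t - y t].
  move=> [x1 x2 x3] [y1 y2 y3] yx; split.
  - by rewrite !sumB // x1 y1.
  - move=> u; rewrite ffunE => d; apply: x2.
    exact: leq_trans d (leq_subr _ _).
  - by move=> J Jinc v; rewrite !sumB // x3 // y3.
have denS x y : sol x -> sol y -> (forall t, y t <= x t) ->
    den [ffun t => x t - y t] = 0 -> x = y.
  move=> [x1 _ _] [y1 _ _] yx d0.
  have d1 : \sum_u [ffun t => x t - y t] (inr u) = 0.
    by rewrite sumB // -x1 -y1 -sumB.
  apply/ffunP => t; apply/eqP; rewrite eqn_leq yx andbT -subn_eq0.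
  case: t => u.
    move/eqP: d0; rewrite /den sum_nat_eq0 => /forallP/(_ u).
    by rewrite ffunE.
  by move/eqP: d1; rewrite sum_nat_eq0 => /forallP/(_ u); rewrite ffunE.
have numB (x y : V) : (forall t, y t <= x t) ->
    num x = num y + num [ffun t => x t - y t].
  by move=> yx; rewrite /num ffunE subnKC.
have denB (x y : V) : (forall t, y t <= x t) ->
    den x = den y + den [ffun t => x t - y t].
  by move=> yx; rewrite /den sumB // subnKC // sumle.
have dx0_gt0 : 0 < den x0 by rewrite dx0; apply: leq_trans leR0.
have [x [sx dx xmax]] := cone_max Sg numB denB denS sx0 dx0_gt0.
have nx_gt0 : 0 < num x.
  have := xmax _ sx0 dx0_gt0; rewrite lt0n; apply: contraTneq => ->.
  by rewrite mul0n -ltnNge muln_gt0 nx0 Rs0_gt0.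
have [nex lex] := of_sol sx nx_gt0.
exists ((num x)%:R / (den x)%:R)%R; split.
  by exists (den x), (num x); split.
move=> _ [R [Rs [Rs_gt0 leR [Psi [Phi /sol_of[y [sy ny dy]]]] ->]]].
have R_gt0 : 0 < R by apply: leq_trans leR.
rewrite ler_pdivrMr ?ltr0n // mulrAC ler_pdivlMr ?ltr0n //.
by rewrite -!natrM ler_nat -ny -dy xmax // dy.
Qed.

End GammaMax.

Lemma gammaP (q p k : nat) : (exists g, Gamma_ratio q p k g) ->
  is_largest (Gamma_ratio q p k) (gamma q p k).
Proof. by move=> /Gamma_ratio_max; apply: xgetPex. Qed.

(* Main.v *)
Require Import Defs.
From mathcomp Require Import all_boot all_order all_algebra.
From mathcomp Require Import zify.

Set Implicit Arguments.
Unset Strict Implicit.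
Unset Printing Implicit Defensive.

Import Order.TTheory GRing.Theory Num.Theory.

(** For [p = q] the pair made of the single row (0, 1, ..., q - 1) on both sides
has ratio 1.  For [p > k], a pair on [q - p + k] columns is turned into a pair
on [q] columns by appending to every row the [p - k] missing columns, where
column j always holds j ([Gamma_ratio_extend]): this adds at most [p - k] values
to a row, and a constraint on an appended column is either vacuous or
impossible, so that frequencies on k columns become frequencies on at most k of
the old columns.

The lower bound is an explicit construction, by induction on the number m of
columns that have already received their final value.  All arrays live on the
columns of the final alphabet; at stage m the role of (0, 1, ..., q - 1) is
played by e_m := (0, ..., m - 1, 0, ..., 0).  Let (A, e_m :: B) be a pair of
strength k + 1 and (A', e_m :: B') a pair of strength k.  Write A'[a] for the
array A' with column m overwritten by a.  The signed array A' - (e_m :: B') is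
balanced on any k columns, hence its tensor product with the difference of
letters [m] - [0] in column m is balanced on any k + 1 columns.  Adding it to
A - (e_m :: B) preserves strength k + 1, and since e_m[0] = e_m and
e_m[m] = e_(m+1), the unwanted row e_m cancels and is replaced with e_(m+1)
([balanced_step]).  The result is

  A ++ A'[m] ++ B'[0]   against   e_(m+1) :: B ++ B'[m] ++ A'[0].

The rows of A'[m] have at most one value more than those of A', as they may.
What needs care is B'[0], which changes sides: hence the invariant that the rows
of B, together with the letter 0, use at most one value more than the strength.

If R(m, k) is the number of rows, then 2 R(m, k) - 1 satisfies the recursion
T(m + 1, k + 1) = T(m, k + 1) + 2 T(m, k), with T(k, k) = T(m, 0) = 1; so does
the sum of binomial products in the statement, by Pascal's rule ([nterms_rec]).
As e_q occurs at least once among R(q, k) rows, the ratio is at least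
1 / R(q, k) = 2 / (T(q, k) + 1). *)

(** * Balance in terms of lists of constraints *)

(** A constraint (j, v) asks for the entry v in column j.  Unlike the increasing
column choices of [matches], lists of constraints are stable under the removal
of some columns, and they may be repeated or contradictory. *)
Definition agrees q (s : seq ('I_q * 'I_q)) (u : word q) : bool :=
  all (fun x => u x.1 == x.2) s.

Definition balanced q k (A B : seq (word q)) : Prop :=
  forall s, size s <= k -> count (agrees s) A = count (agrees s) B.

Lemma matches_agrees q k (J v : 'I_k -> 'I_q) :
  matches J v =1 agrees [seq (J l, v l) | l <- enum 'I_k].
Proof.
move=> u; rewrite /agrees all_map; apply/forallP/allP => [h l _|h l]; first exact: h.
by apply: h; rewrite mem_enum.
Qed.

(** Frequencies on fewer than k columns are sums of frequencies on exactly k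
columns, so both notions of balance agree as soon as there are k columns. *)
Lemma balanced_differenceP R q k (Psi Phi : array R q) : k <= q ->
  balanced_difference k Psi Phi <-> balanced k Psi Phi.
Proof.
move=> le_kq; split=> [bal s le_s|bal J _ v]; last first.
  by rewrite !(eq_count (matches_agrees J v)) bal // size_map size_enum_ord.
(* D is a set of exactly k columns containing those that s constrains; J lists
   it in increasing order. *)
pose C := [set x.1 | x in s].
have le_C : #|C| <= k.
  by apply: leq_trans (leq_imset_card _ _) (leq_trans (card_size s) le_s).
pose t := enum C ++ take (k - #|C|) (enum (~: C)).
pose D := [set x in t].
have cardD : #|D| = k.
  rewrite cardsE (card_uniqP _).
    have cardC := cardsC C; rewrite card_ord in cardC.
    by rewrite size_cat -cardE size_takel ?subnKC // -cardE; lia.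
  rewrite cat_uniq enum_uniq take_uniq ?enum_uniq // andbT.
  apply/hasPn => x /mem_take; rewrite !mem_enum inE; exact.
have CD x : x \in s -> x.1 \in D.
  by move=> xs; rewrite inE mem_cat mem_enum imset_f.
pose J (l : 'I_k) : 'I_q := enum_val (cast_ord (esym cardD) l).
have Jinc (l m : 'I_k) : l < m -> J l < J m.
  move=> lm; rewrite /J.
  have x0 : 'I_q by exact: (J l).
  have srt : sorted (fun a b : 'I_q => a < b) (enum D).
    rewrite /enum_mem; apply: sorted_filter => [a b c|]; first exact: ltn_trans.
    by have := iota_ltn_sorted 0 q; rewrite -val_enum_ord sorted_map enumT.
  rewrite !(enum_val_nth x0); apply: (sorted_ltn_nth _ x0 srt) => //=.
  - by move=> a b c; apply: ltn_trans.
  - by rewrite inE -cardE cardD.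
  - by rewrite inE -cardE cardD.
(* Whether u satisfies s depends only on its trace on D. *)
pose tr (u : word q) : {ffun 'I_k -> 'I_q} := [ffun l => u (J l)].
have Jsurj x : x \in D -> exists l, J l = x.
  move=> xD; exists (cast_ord cardD (enum_rank_in xD x)).
  by rewrite /J cast_ordK enum_rankK_in.
pose Q (v : {ffun 'I_k -> 'I_q}) :=
  all (fun x => [forall l, (J l == x.1) ==> (v l == x.2)]) s.
have agreesQ u : agrees s u = Q (tr u).
  apply: eq_in_all => x /CD /Jsurj[l Jl].
  apply/idP/forallP => [ux m|/(_ l)].
    by apply/implyP => /eqP Jm; rewrite ffunE Jm.
  by rewrite ffunE Jl eqxx.
suff E (A : seq (word q)) : count (agrees s) A = \sum_(v | Q v) count (matches J v) A.
  by rewrite !E; apply: eq_bigr => v _; apply: bal.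
elim: A => [|u A IH] /=; first by rewrite big1.
rewrite big_split -IH /=; congr (_ + _).
have mE (v : {ffun 'I_k -> 'I_q}) : matches J v u = (v == tr u).
  apply/forallP/eqP => [h|-> l]; last by rewrite ffunE.
  by apply/ffunP => l; rewrite ffunE (eqP (h l)).
rewrite agreesQ; under eq_bigr do rewrite mE.
rewrite -big_mkcondr /=.
case: (boolP (Q _)) => Qu.
  rewrite (bigD1 (tr u)) /= ?Qu ?eqxx // big1 // => v /andP[/andP[_ ->]] //.
by rewrite big1 // => v /andP[Qv /eqP vE]; rewrite -vE Qv in Qu.
Qed.

(** * Appending identity columns *)

Section Extension.

Variables q d : nat.

Definition extend_word (u : word q) : word (q + d) :=
  [ffun j => match split j with inl i => lshift d (u i) | inr i => rshift q i end].

Lemma extend_word_lshift u i : extend_word u (lshift d i) = lshift d (u i).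
Proof. by rewrite ffunE -[lshift d i]/(unsplit (inl i)) unsplitK. Qed.

Lemma extend_word_rshift u i : extend_word u (rshift q i) = rshift q i.
Proof. by rewrite ffunE -[rshift q i]/(unsplit (inr i)) unsplitK. Qed.

Lemma extend_word_eq_id u : (extend_word u == idword (q + d)) = (u == idword q).
Proof.
apply/eqP/eqP => [/ffunP h|->].
  apply/ffunP => j; have := h (lshift d j).
  by rewrite extend_word_lshift !ffunE => /lshift_inj.
apply/ffunP => j; rewrite -(splitK j); case: (split j) => i /=.
  by rewrite extend_word_lshift !ffunE.
by rewrite extend_word_rshift ffunE.
Qed.

Lemma nvalues_extend_word u : nvalues (extend_word u) <= nvalues u + d.
Proof.
rewrite /nvalues -[X in _ <= _ + X]card_ord.
apply: leq_trans (leq_add (leq_imset_card (lshift d) _) (leq_imset_card (@rshift q d) _)).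
apply: leq_trans (leq_card_setU _ _); apply: subset_leq_card.
apply/fintype.subsetP => _ /imsetP[j _ ->]; rewrite -(splitK j); case: (split j) => i /=.
  by rewrite extend_word_lshift inE; apply/orP; left; rewrite !imset_f.
by rewrite extend_word_rshift inE; apply/orP; right; rewrite imset_f.
Qed.

(** A constraint between an old column and a new letter, or conversely, is
impossible; one on a new column does not depend on the word. *)
Lemma agrees_extend_word (s : seq ('I_(q + d) * 'I_(q + d))) :
  exists (s' : seq ('I_q * 'I_q)) (b : bool), size s' <= size s /\
    forall u, agrees s (extend_word u) = b && agrees s' u.
Proof.
elim: s => [|[j v] s [s' [b [le_s' IH]]]]; first by exists [::], true.
rewrite -(splitK j) -(splitK v); case: (split j) => i /=; case: (split v) => w /=.
- exists ((i, w) :: s'), b; split=> // u.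
  by rewrite extend_word_lshift IH (inj_eq (@lshift_inj q d)) andbCA.
- exists s', false; split=> [|u]; first exact: leqW.
  by rewrite extend_word_lshift eq_lrshift.
- exists s', false; split=> [|u]; first exact: leqW.
  by rewrite extend_word_rshift eq_rlshift.
- exists s', ((i == w) && b); split=> [|u]; first exact: leqW.
  by rewrite extend_word_rshift IH (inj_eq (@rshift_inj q d)) andbA.
Qed.

Lemma Gamma_ratio_extend p k g : k <= q ->
  Gamma_ratio q p k g -> Gamma_ratio (q + d) (p + d) k g.
Proof.
move=> le_kq [R [Rs [Rs_gt0 le_R [Psi [Phi [[idPhi PsiP bal] cnt]]] ->]]].
exists R, Rs; split=> //.
have cntE : count_mem (idword (q + d)) (map extend_word Phi) = Rs.
  by rewrite count_map -cnt; apply: eq_count => u /=; apply: extend_word_eq_id.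
exists (map_tuple extend_word Psi), (map_tuple extend_word Phi); split=> //; split.
- by rewrite -has_pred1 has_count cntE.
- rewrite all_map; apply: sub_all PsiP => u /= le_u.
  by apply: leq_trans (nvalues_extend_word u) _; rewrite leq_add2r.
- apply/balanced_differenceP => [|s le_s]; first exact: leq_trans (leq_addr _ _).
  have [s' [b [le_s' sE]]] := agrees_extend_word s.
  rewrite !count_map !(eq_count (sE : preim _ _ =1 _)).
  case: b {sE} => /=; last by rewrite !count_pred0.
  move/(balanced_differenceP Psi Phi le_kq): bal; apply.
  exact: leq_trans le_s.
Qed.

End Extension.

(** * The number of terms of the construction *)

Definition nterms q k := \sum_(0 <= r < k.+1) 'C(q, r) * 'C(q - 1 - r, k - r).

Lemma nterms0 q : nterms q 0 = 1.
Proof. by rewrite /nterms big_nat1 !bin0. Qed.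

Lemma nterms_diag k : nterms k k = 1.
Proof.
rewrite /nterms big_nat_recr //= binn subnn bin0 big_nat big1 // => r /andP[_ lt_rk].
by rewrite (@bin_small (k - 1 - r)) ?muln0 //; lia.
Qed.

Lemma nterms_rec q k : k < q ->
  nterms q.+1 k.+1 = nterms q k.+1 + (nterms q k).*2.
Proof.
move=> lt_kq; rewrite /nterms big_nat_recl //= bin0 mul1n !subn0.
under eq_bigr do rewrite binS mulnDl.
rewrite big_split /= -addnn !addnA; congr (_ + _); last first.
  (* The part of Pascal's rule with C(q, r - 1), shifted to start at r = 0. *)
  by apply: eq_big_nat => r _; congr (_ * 'C(_, _)); lia.
transitivity (\sum_(0 <= r < k.+2) 'C(q, r) * 'C(q - r, k.+1 - r)).
  (* The part with C(q, r), whose r = 0 term had been set apart. *)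
  by rewrite [RHS]big_nat_recl //= bin0 mul1n !subn0 subn1.
rewrite big_nat_recr //= [in RHS]big_nat_recr //= subnn !bin0.
rewrite addnAC; congr (_ + _); rewrite -big_split /=.
apply: eq_big_nat => r /andP[_ le_rk].
rewrite -mulnDr; congr (_ * _).
have -> : q - r = (q - 1 - r).+1 by lia.
by rewrite subSn // binS.
Qed.

(** * The inductive construction *)

Lemma card_setU1_leS (T : finType) (x : T) (A : {set T}) : #|x |: A| <= #|A|.+1.
Proof. by rewrite cardsU1 -add1n leq_add2r leq_b1. Qed.

Section Construction.

Variable n : nat.
Implicit Types (u : word n.+1) (m a : 'I_n.+1) (k : nat).

Definition partial_id (m : nat) : word n.+1 :=
  [ffun j : 'I_n.+1 => if j < m then j else ord0].

Definition upd u m a : word n.+1 := [ffun j => if j == m then a else u j].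

(** With the letter 0 always counted, overwriting a column with 0 cannot increase
this number. *)
Definition nvalues0 u : nat := #|ord0 |: [set u j | j : 'I_n.+1]|.

Lemma upd_partial_id0 m : upd (partial_id m) m ord0 = partial_id m.
Proof.
by apply/ffunP => j; rewrite !ffunE; case: eqP => // ->; rewrite ltnn.
Qed.

Lemma upd_partial_id m : upd (partial_id m) m m = partial_id m.+1.
Proof.
apply/ffunP => j; rewrite !ffunE ltnS (leq_eqVlt j).
by have [->|ne_jm] := eqVneq j m; [rewrite eqxx | rewrite (negPf (ne_jm : val j != val m))].
Qed.

Lemma partial_id_full : partial_id n.+1 = idword n.+1.
Proof. by apply/ffunP => j; rewrite !ffunE ltn_ord. Qed.

Lemma nvalues_le_nvalues0 u : nvalues u <= nvalues0 u.
Proof. by rewrite subset_leq_card // subsetUr. Qed.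

Lemma nvalues0_leS u : nvalues0 u <= (nvalues u).+1.
Proof. by exact: card_setU1_leS. Qed.

Lemma upd_values u m a :
  [set upd u m a j | j : 'I_n.+1] \subset a |: [set u j | j : 'I_n.+1].
Proof.
apply/fintype.subsetP => _ /imsetP[j _ ->]; rewrite ffunE !inE.
by case: (j == m); rewrite ?eqxx // imset_f ?orbT.
Qed.

Lemma nvalues_upd u m a : nvalues (upd u m a) <= (nvalues u).+1.
Proof.
apply: leq_trans (subset_leq_card (upd_values u m a)) _.
exact: card_setU1_leS.
Qed.

Lemma nvalues0_upd u m a : nvalues0 (upd u m a) <= (nvalues0 u).+1.
Proof.
apply: leq_trans (subset_leq_card (setUS _ (upd_values u m a))) _.
by rewrite setUCA; apply: card_setU1_leS.
Qed.

Lemma nvalues0_upd0 u m : nvalues0 (upd u m ord0) <= nvalues0 u.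
Proof.
apply: leq_trans (subset_leq_card (setUS _ (upd_values u m ord0))) _.
by rewrite setUA setUid.
Qed.

Lemma count_agrees_upd s m a (A : seq (word n.+1)) :
  count (agrees s) [seq upd u m a | u <- A] =
  all (fun x => (x.1 == m) ==> (a == x.2)) s *
    count (agrees [seq x <- s | x.1 != m]) A.
Proof.
rewrite count_map; set b := all _ s; set s' := filter _ s.
have E : preim (fun u => upd u m a) (agrees s) =1 fun u => b && agrees s' u.
  move=> u; rewrite /agrees /b /s' all_filter -all_predI /=.
  by apply: eq_all => x /=; rewrite ffunE; case: (x.1 == m); rewrite ?andbT.
rewrite (eq_count E).
by case: b {E}; rewrite ?mul1n ?mul0n ?count_pred0.
Qed.

(** This is the equality of the two sides of (A - B) tensored with the difference
of the letters a and b.  If a constraint bears on column m, the others number at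
most k and A, B agree on them; otherwise a and b play the same role. *)
Lemma count_agrees_upd_swap k (A B : seq (word n.+1)) m a b s :
  balanced k A B -> size s <= k.+1 ->
  count (agrees s) [seq upd u m a | u <- A] + count (agrees s) [seq upd u m b | u <- B] =
  count (agrees s) [seq upd u m a | u <- B] + count (agrees s) [seq upd u m b | u <- A].
Proof.
move=> bal le_s; rewrite !count_agrees_upd.
have [/hasP[x xs xm]|/hasPn sm] := boolP (has (fun x => x.1 == m) s).
  rewrite bal // size_filter -ltnS; apply: leq_trans le_s.
  rewrite -(count_predC (fun x => x.1 == m)) -add1n leq_add2r -has_count.
  by apply/hasP; exists x.
have one c : all (fun x : 'I_n.+1 * 'I_n.+1 => (x.1 == m) ==> (c == x.2)) s.
  by apply/allP => x /sm /negPf ->.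
by rewrite !one addnC.
Qed.

(** The swap produces e_(m+1) on one side and e_m on the other; the latter is
removed from both sides against the e_m of the first pair. *)
Lemma balanced_step k m (A B A' B' : seq (word n.+1)) :
  balanced k.+1 A (partial_id m :: B) -> balanced k A' (partial_id m :: B') ->
  balanced k.+1
    (A ++ [seq upd u m m | u <- A'] ++ [seq upd u m ord0 | u <- B'])
    (partial_id m.+1 ::
       B ++ [seq upd u m m | u <- B'] ++ [seq upd u m ord0 | u <- A']).
Proof.
move=> bal bal' s le_s.
have swap := count_agrees_upd_swap m m ord0 bal' le_s; move: swap (bal _ le_s).
rewrite /= upd_partial_id0 upd_partial_id !count_cat; lia.
Qed.

(** The pair of lower strength used in the step.  No row has 0 values, so a pair
of strength 0 cannot meet the bound on the number of values; the constant row m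
is used instead, since overwriting its column m with m creates no value. *)
Lemma seed_pair k m :
  (0 < k -> exists A B : seq (word n.+1),
    [/\ (size A).*2 = nterms m k + 1, all (fun u => nvalues u <= k) A,
        all (fun u => nvalues0 u <= k.+1) B & balanced k A (partial_id m :: B)]) ->
  exists A B : seq (word n.+1),
    [/\ (size A).*2 = nterms m k + 1,
        all (fun u => (nvalues (upd u m m) <= k.+1) && (nvalues0 (upd u m ord0) <= k.+2)) A,
        all (fun u => nvalues0 u <= k.+1) B & balanced k A (partial_id m :: B)].
Proof.
case: k => [_|k ex].
  pose c : word n.+1 := [ffun=> m].
  exists [:: c], [::]; split=> //; first by rewrite nterms0.
  - rewrite /= andbT; apply/andP; split.
      rewrite -(cards1 m); apply: subset_leq_card; apply/fintype.subsetP => _ /imsetP[j _ ->].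
      by rewrite !ffunE if_same inE.
    apply: leq_trans (nvalues0_upd0 _ _) _; apply: leq_trans (nvalues0_leS _) _.
    rewrite ltnS -(cards1 m); apply: subset_leq_card; apply/fintype.subsetP => _ /imsetP[j _ ->].
    by rewrite !ffunE inE.
  - by case.
have [A [B [sA vA vB bal]]] := ex isT.
exists A, B; split=> //; apply: sub_all vA => u le_u.
rewrite (leq_trans (nvalues_upd _ _ _)) //=.
apply: leq_trans (nvalues0_upd0 _ _) _.
by apply: leq_trans (nvalues0_leS _) _; rewrite ltnS leqW.
Qed.

Lemma exists_reduction_pair k (m : nat) : 0 < k -> k <= m -> m <= n.+1 ->
  exists A B : seq (word n.+1),
    [/\ (size A).*2 = nterms m k + 1, all (fun u => nvalues u <= k) A,
        all (fun u => nvalues0 u <= k.+1) B & balanced k A (partial_id m :: B)].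
Proof.
elim: m k => [|m IH] k k_gt0; first by rewrite leqNgt k_gt0.
rewrite leq_eqVlt => /orP[/eqP-> le_mn|lt_km lt_mn].
  exists [:: partial_id m.+1], [::]; split=> //; first by rewrite nterms_diag.
  rewrite /= andbT.
  have /subset_leq_card/leq_trans -> // : [set partial_id m.+1 j | j : 'I_n.+1]
      \subset [set widen_ord le_mn i | i : 'I_m.+1].
    apply/fintype.subsetP => _ /imsetP[j _ ->]; rewrite ffunE; case: ltnP => [lt_jm|_].
      by apply/imsetP; exists (Ordinal lt_jm) => //; apply: val_inj.
    by apply/imsetP; exists ord0 => //; apply: val_inj.
  by rewrite (leq_trans (leq_imset_card _ _)) ?card_ord.
case: k k_gt0 lt_km => // k _ lt_km.
have [A [B [sA vA vB bal]]] := IH k.+1 isT lt_km (ltnW lt_mn).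
pose i := Ordinal lt_mn.
have [] := @seed_pair k i.
  by move=> k_gt0; apply: IH => //; exact: ltnW.
move=> A' [B' [sA' vA' vB' bal']].
exists (A ++ [seq upd u i i | u <- A'] ++ [seq upd u i ord0 | u <- B']).
exists (B ++ [seq upd u i i | u <- B'] ++ [seq upd u i ord0 | u <- A']); split.
- have := bal' [::] (leq0n _); rewrite !count_predT /= => sB'.
  rewrite nterms_rec // !size_cat !size_map; move: sA sA' sB' => /=; lia.
- rewrite !all_cat vA !all_map /=; apply/andP; split.
    by apply: sub_all vA' => u /andP[].
  apply: sub_all vB' => u; apply: leq_trans.
  exact: leq_trans (nvalues_le_nvalues0 _) (nvalues0_upd0 _ _).
- rewrite !all_cat vB !all_map /=; apply/andP; split.
    by apply: sub_all vB' => u le_u; apply: leq_trans (nvalues0_upd _ _ _) _.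
  by apply: sub_all vA' => u /andP[].
- exact: balanced_step.
Qed.

End Construction.

Lemma Gamma_ratio_lower q k : 0 < k -> k <= q ->
  exists2 g, Gamma_ratio q k k g & (2%:R / (nterms q k + 1)%:R <= g)%R.
Proof.
case: q => [|n] k_gt0 le_kq; first by case: k k_gt0 le_kq.
have [A [B [sA vA _ bal]]] := exists_reduction_pair k_gt0 le_kq (leqnn n.+1).
rewrite partial_id_full in bal.
have sB : size (idword n.+1 :: B) == size A.
  by have := bal [::] (leq0n _); rewrite !count_predT => ->.
pose Rs := count_mem (idword n.+1) (idword n.+1 :: B).
have Rs_gt0 : 0 < Rs by rewrite /Rs /= eqxx.
have le_Rs : Rs <= size A by rewrite -(eqP sB) count_size.
exists (Rs%:R / (size A)%:R)%R.
  exists (size A), Rs; split=> //.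
  exists (in_tuple A), (Tuple sB); split=> //; split=> //; first exact: mem_head.
  exact/balanced_differenceP.
have R_gt0 : 0 < size A by apply: leq_trans le_Rs.
rewrite -sA -mul2n natrM invfM mulrA divff ?mul1r ?pnatr_eq0 //.
by rewrite ler_peMl ?invr_ge0 ?ler0n // ler1n.
Qed.

Lemma Gamma_ratio_diag q k : Gamma_ratio q q k 1%R.
Proof.
exists 1, 1; split=> //.
exists [tuple idword q], [tuple idword q]; split; last by rewrite /= eqxx.
split=> //; first exact: mem_head.
by rewrite /= andbT (leq_trans (leq_imset_card _ _)) ?card_ord.
Qed.

Lemma Gamma_ratio_le1 q p k g : Gamma_ratio q p k g -> (g <= 1)%R.
Proof.
move=> [R [Rs [Rs_gt0 le_R _ ->]]].
by rewrite ler_pdivrMr ?ltr0n ?(leq_trans Rs_gt0) // mul1r ler_nat.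
Qed.

Theorem theorem3p3 (q p k : nat) (k_gt0 : 0 < k) (le_kp : k <= p) (le_pq : p <= q) :
  [/\ p = q -> gamma q q k = 1%R,
      k < p -> (gamma (q - p + k) k k <= gamma q p k)%R
    & p = k -> k < q ->
      (2%:R / (\sum_(0 <= r < k.+1) 'C(q, r) * 'C(q - 1 - r, k - r) + 1)%:R
         <= gamma q k k)%R].
Proof.
split=> [_|lt_kp|_ lt_kq].
- have [] := gammaP (ex_intro _ _ (Gamma_ratio_diag q k)).
  move=> /Gamma_ratio_le1 le1 /(_ _ (Gamma_ratio_diag q k)) ge1.
  by apply/eqP; rewrite eq_le le1.
- have le_k := leq_addl (q - p) k.
  have [g gP _] := Gamma_ratio_lower k_gt0 le_k.
  have [gmP _] := gammaP (ex_intro _ _ gP).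
  have := Gamma_ratio_extend (p - k) le_k gmP.
  have -> : q - p + k + (p - k) = q by lia.
  rewrite subnKC // => ratio.
  by have [_] := gammaP (ex_intro _ _ ratio); apply.
- have [g gP le_g] := Gamma_ratio_lower k_gt0 (ltnW lt_kq).
  have [_ /(_ _ gP)] := gammaP (ex_intro _ _ gP).
  exact: le_trans.
Qed.
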